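(* Let $k$ be an algebraically closed field and $A$ a finite-dimensional unital associative $k$-algebra. There is a bijection between the set of isomorphism classes of indecomposable modules in $\mathrm{mod}\,A$ and the set of completely join-irreducible elements of the lattice $\mathcal{L}_t(A)$ of pretorsion classes of $\mathrm{mod}\,A$, given by $M\mapsto \mathrm{Gen}(M)$.
   Context: $\mathrm{mod}\,A$ is the category of finitely generated right $A$-modules. All subcategories are full and closed under isomorphisms. A pretorsion class of $\mathrm{mod}\,A$ is a subcategory containing $0$ and closed under quotients and finite direct sums. $\mathcal{L}_t(A)$ is the set of pretorsion classes of $\mathrm{mod}\,A$ ordered by inclusion; it is a complete lattice. For a class $\mathcal{S}$ of modules, $\mathrm{Gen}(\mathcal{S})$ is the smallest pretorsion class containing $\mathcal{S}$, i.e. the subcategory of all quotients of finite direct sums of modules in $\mathcal{S}$; $\mathrm{Gen}(M)=\mathrm{Gen}(\{M\})$. An element $x$, different from the bottom element, of a lattice $\mathcal{L}$ is completely join-irreducible if there is $x_0\in\mathcal{L}$, $x_0\neq x$, such that for every $a\in\mathcal{L}$, $a<x$ if and only if $a\leq x_0$ (in a complete lattice: $\bigvee_{a<x}a<x$). *)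

(* Defs.v *)
From HB Require Import structures.
From mathcomp Require Import all_boot all_order all_algebra all_field.

Set Implicit Arguments.
Unset Strict Implicit.
Unset Printing Implicit Defensive.

Import GRing.Theory.
Local Open Scope ring_scope.

(* Classes of modules are plain predicates [rmod A -> Prop]: the mathcomp      *)
(* universe constraints put [lmodType _] strictly above the universe of        *)
(* [classical_sets.set] and of [choiceType], so neither [set (rmod A)] nor a   *)
(* [porderType] of pretorsion classes typechecks.                              *)

(** * Finitely generated right modules *)

Definition finitely_generated (R : pzRingType) (M : lmodType R) : Prop :=
  exists (n : nat) (g : 'I_n -> M),
    forall x : M, exists a : 'I_n -> R, x = \sum_(i < n) a i *: g i.

(* A right A-module is a left module over the opposite ring A^c. *)
Record rmod (A : pzRingType) := RMod {
  rmod_sort :> lmodType A^c;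
  rmod_fg : finitely_generated rmod_sort }.

Section Modules.
Variable A : pzRingType.
Implicit Types M N P : rmod A.

Definition is_zero M : Prop := forall x : M, x = 0.

Definition isomorphic M N : Prop := exists f : {linear M -> N}, bijective f.

(* N is, up to isomorphism, a quotient of M. *)
Definition quotient_of M N : Prop :=
  exists f : {linear M -> N}, forall y : N, exists x : M, f x = y.

Lemma dsum_fg M N : finitely_generated (M * N)%type.
Proof.
have [m [g gP]] := rmod_fg M; have [n [h hP]] := rmod_fg N.
exists (m + n)%N, (fun i => match split i with
  | inl j => (g j, 0) | inr j => (0, h j) end) => -[x y].
have [a ->] := gP x; have [b ->] := hP y.
exists (fun i => match split i with inl j => a j | inr j => b j end).
rewrite big_split_ord /=.
have splitl i : split (lshift n i) = inl i := unsplitK (inl i).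
have splitr i : split (rshift m i) = inr i := unsplitK (inr i).
have inlE : {morph (fun u : M => (u, 0) : M * N) : u v / u + v >-> u + v}.
  by move=> u v; congr pair; rewrite /= addr0.
have inrE : {morph (fun v : N => (0, v) : M * N) : u v / u + v >-> u + v}.
  by move=> u v; congr pair; rewrite /= addr0.
rewrite (eq_bigr (fun i => (a i *: g i, 0))) => [|i _]; last first.
  by rewrite splitl; congr pair; rewrite /= scaler0.
rewrite [X in _ = _ + X](eq_bigr (fun i => (0, b i *: h i))) => [|i _]; last first.
  by rewrite splitr; congr pair; rewrite /= scaler0.
rewrite -(big_morph _ inlE erefl) -(big_morph _ inrE erefl).
by congr pair; rewrite /= ?addr0 ?add0r.
Qed.

Definition dsum M N : rmod A := RMod (dsum_fg M N).

Definition indecomposable M : Prop :=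
  ~ is_zero M /\
  forall X Y : rmod A, isomorphic M (dsum X Y) -> is_zero X \/ is_zero Y.

(** * Pretorsion classes *)

Record is_pretorsion (C : rmod A -> Prop) : Prop := IsPretorsion {
  pretorsion_iso : forall M N, isomorphic M N -> C M -> C N;
  pretorsion_zero : forall M, is_zero M -> C M;
  pretorsion_quotient : forall M N, quotient_of M N -> C M -> C N;
  pretorsion_dsum : forall M N, C M -> C N -> C (dsum M N) }.

End Modules.

Record pretorsion_class (A : pzRingType) := PretorsionClass {
  in_class :> rmod A -> Prop;
  in_classP : is_pretorsion in_class }.

Definition pretorsion_le (A : pzRingType) (C D : pretorsion_class A) : Prop :=
  forall M : rmod A, C M -> D M.

Section Generation.
Variable A : pzRingType.
Implicit Types (M N : rmod A) (S : rmod A -> Prop) (C : pretorsion_class A).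

(* The intersection of all pretorsion classes containing S. *)
Definition Gen_set S : rmod A -> Prop := fun M =>
  forall C, (forall N, S N -> C N) -> C M.

Lemma Gen_pretorsion S : is_pretorsion (Gen_set S).
Proof.
split=> [M N iMN GM C SC|M M0 C _|M N qMN GM C SC|M N GM GN C SC].
- exact: (pretorsion_iso (in_classP C) iMN (GM C SC)).
- exact: (pretorsion_zero (in_classP C)).
- exact: (pretorsion_quotient (in_classP C) qMN (GM C SC)).
- exact: (pretorsion_dsum (in_classP C) (GM C SC) (GN C SC)).
Qed.

Definition Gen S : pretorsion_class A := PretorsionClass (Gen_pretorsion S).

Definition Gen1 M : pretorsion_class A := Gen (fun N => N = M).

Lemma sub_Gen S M : S M -> Gen S M.
Proof. by move=> SM C; apply. Qed.

Lemma Gen_least S C : (forall M, S M -> C M) -> pretorsion_le (Gen S) C.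
Proof. by move=> SC M; apply. Qed.

Lemma Gen_lub (F : pretorsion_class A -> Prop) :
  let J := Gen (fun M => exists C, F C /\ C M) in
  (forall C, F C -> pretorsion_le C J) /\
  (forall D, (forall C, F C -> pretorsion_le C D) -> pretorsion_le J D).
Proof.
split=> [C FC M CM|D FD]; first by apply: sub_Gen; exists C.
by apply: Gen_least => M [C [FC CM]]; apply: FD CM.
Qed.

Lemma zero_fg : finitely_generated ('rV[A^c]_0).
Proof.
by exists 0%N, (fun=> 0) => x; exists (fun=> 0); rewrite big_ord0; apply/rowP=> -[].
Qed.

Definition rmod0 : rmod A := RMod zero_fg.

Definition bigdsum (s : seq (rmod A)) : rmod A := foldr (@dsum A) rmod0 s.

Fixpoint all_in S (s : seq (rmod A)) : Prop :=
  if s is M :: s' then S M /\ all_in S s' else True.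

Let quot M N (f : M -> N) :
  linear f -> (forall y, exists x, f x = y) -> quotient_of M N.
Proof.
move=> fL fS; pose F := GRing.isLinear.Build _ _ _ _ f fL.
pose fF : {linear M -> N} := HB.pack f F.
by exists fF.
Qed.

Let quot_trans M N P : quotient_of M N -> quotient_of N P -> quotient_of M P.
Proof.
case=> f fS [g gS]; apply: (@quot _ _ (fun x => g (f x))) => [a x y|z].
  by rewrite !linearP.
by have [y <-] := gS z; have [x <-] := fS y; exists x.
Qed.

Let quot_dsum M N M' N' : quotient_of M M' -> quotient_of N N' ->
  quotient_of (dsum M N) (dsum M' N').
Proof.
case=> f fS [g gS].
apply: (@quot (dsum M N) (dsum M' N') (fun x => (f x.1, g x.2)))
  => [a [x x'] [y y']|[z z']].
  by rewrite /= !linearP.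
by have [x <-] := fS z; have [x' <-] := gS z'; exists (x, x').
Qed.

Let quot_cat (s t : seq (rmod A)) :
  quotient_of (bigdsum (s ++ t)) (dsum (bigdsum s) (bigdsum t)).
Proof.
elim: s => [|M s IHs] /=.
  apply: (@quot (bigdsum t) (dsum rmod0 (bigdsum t)) (fun x => (0, x)))
    => [a x y|[z z']].
    by congr pair; rewrite /= scaler0 addr0.
  by exists z'; congr pair; apply/rowP=> -[].
have: quotient_of (dsum M (bigdsum (s ++ t)))
                  (dsum M (dsum (bigdsum s) (bigdsum t))).
  by apply: quot_dsum IHs; exists idfun => y; exists y.
move/quot_trans; apply.
apply: (@quot (dsum M (dsum (bigdsum s) (bigdsum t)))
              (dsum (dsum M (bigdsum s)) (bigdsum t))
              (fun x => ((x.1, x.2.1), x.2.2))) => [//|[[x y] z]].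
by exists (x, (y, z)).
Qed.

Let all_in_cat S s t : all_in S s -> all_in S t -> all_in S (s ++ t).
Proof. by elim: s => //= M s IHs [SM Ss] St; split=> //; apply: IHs. Qed.

Let iso_quot M N : isomorphic M N -> quotient_of M N.
Proof. by case=> f [g _ gK]; exists f => y; exists (g y). Qed.

(* Gen(S) consists of the quotients of finite direct sums of modules in S. *)
Lemma GenE S M :
  Gen S M <->
  exists s : seq (rmod A), all_in S s /\ quotient_of (bigdsum s) M.
Proof.
split=> [GM|[s [Ss sM]] C SC]; last first.
  apply: (pretorsion_quotient (in_classP C) sM).
  elim: s Ss {sM} => [_|N s IHs [/SC CN /IHs Cs]] /=.
    by apply: (pretorsion_zero (in_classP C)) => x; apply/rowP=> -[].
  exact: (pretorsion_dsum (in_classP C)).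
suff QP : is_pretorsion (fun N => exists s, all_in S s /\ quotient_of (bigdsum s) N).
  apply: (GM (PretorsionClass QP)) => N SN; exists [:: N]; split=> //=.
  apply: (@quot (dsum N rmod0) N (fun x => x.1)) => // y.
  by exists (y, 0).
split=> [M1 N1 /iso_quot iMN [s [Ss sM]]|M1 M0|M1 N1 qMN [s [Ss sM]]|
         M1 N1 [s [Ss sM]] [t [St tN]]].
- by exists s; split=> //; apply: quot_trans iMN.
- exists [::]; split=> //; apply: (@quot rmod0 M1 (fun=> 0)) => [a x y|y].
    by rewrite scaler0 addr0.
  by exists 0; rewrite [y]M0.
- by exists s; split=> //; apply: quot_trans qMN.
- exists (s ++ t); split; first exact: all_in_cat.
  exact: quot_trans (quot_cat s t) (quot_dsum sM tN).
Qed.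

End Generation.

(** * Completely join-irreducible elements *)

Section JoinIrreducible.
Variables (L : Type) (le : L -> L -> Prop).

Definition strictly_below (a x : L) : Prop := le a x /\ a <> x.

Definition is_bottom (x : L) : Prop := forall a, le x a.

Definition completely_join_irreducible (x : L) : Prop :=
  ~ is_bottom x /\
  exists x0 : L, x0 <> x /\ forall a, strictly_below a x <-> le a x0.

End JoinIrreducible.

Definition cji_pretorsion (A : pzRingType) : Type :=
  {C : pretorsion_class A | completely_join_irreducible (@pretorsion_le A) C}.

(** * Isomorphism classes of indecomposable modules *)

Definition iso_class (A : pzRingType) (M : rmod A) : rmod A -> Prop :=
  fun N => isomorphic M N.

Definition indec_iso_class (A : pzRingType) : Type :=
  {K : rmod A -> Prop | exists M : rmod A, indecomposable M /\ K = iso_class M}.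

Definition to_indec_iso_class (A : pzRingType) (M : rmod A)
    (hM : indecomposable M) : indec_iso_class A :=
  exist _ (iso_class M) (ex_intro _ M (conj hM erefl)).

(* Main.v *)
Require Import Defs.
From HB Require Import structures.
From mathcomp Require Import all_boot all_order all_algebra all_field.
From Stdlib Require Import Classical FunctionalExtensionality.
From Stdlib Require Import PropExtensionality ProofIrrelevance.

Set Implicit Arguments.
Unset Strict Implicit.
Unset Printing Implicit Defensive.

Import GRing.Theory.
Local Open Scope ring_scope.

(* The endomorphism ring E of an indecomposable M is local by Fitting's       *)
(* lemma. If M lies in Gen(S) and S in Gen(M), then M is the sum of the       *)
(* images of the composites M -> N -> M with N in S; by Nakayama's lemma over *)
(* E some such composite is invertible, so M is a direct summand of a module  *)
(* of S. With S = {N}, N indecomposable, this shows that Gen is injective on  *)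
(* isomorphism classes; with S = {N, N'} it shows that the modules of Gen(M)  *)
(* that do not generate M form a pretorsion class, the largest one strictly   *)
(* below Gen(M). Conversely a pretorsion class is the join of the Gen(M) for  *)
(* M in it indecomposable, so if it is completely join-irreducible it equals  *)
(* one of them.                                                               *)

(** An indecomposable [M] is a nonzero finite-dimensional space, and its endomorphisms are the
    square matrices commuting with the action of [A]. Their only idempotents are 0 and 1, so each is
    nilpotent or invertible, and the non-invertible ones form a proper ideal whose image cannot be
    all of [M]. This gives the key lemma [indecomposable_retract]. From it follow injectivity
    ([Gen1_indecomposable_inj]) and irreducibility of [Gen1 M] ([indecomposable_cji]). Surjectivity
    ([cji_indecomposable]) rests on decomposing modules into indecomposables. *)

Lemma nilpotent_sub1_unit (R : unitRingType) (x : R) m :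
  x ^+ m = 0 -> 1 - x \is a GRing.unit.
Proof.
move=> xm0; have cx : GRing.comm 1 x by apply: commr_sym; apply: commr1.
have := subrXX_comm m cx; rewrite expr1n xm0 subr0.
set s := \sum_(_ < _) _ => e1.
have cs : GRing.comm (1 - x) s.
  apply/commr_sym/commrB; first exact: commr1.
  apply/commr_sym/commr_sum => i _; apply: commrM; last exact: commrX.
  by rewrite expr1n; apply: commr1.
by apply/unitrP; exists s; rewrite -cs -e1.
Qed.

(** The idempotent is the projection onto the part where [X] is invertible, along the generalized
    kernel. Being a polynomial in [X], it commutes with whatever commutes with [X]. *)
Lemma fitting_idempotent (k : fieldType) n (X : 'M[k]_n.+1) :
  exists p : {poly k}, exists m,
    let e := horner_mx X p in
    [/\ e * e = e, e = 0 -> X ^+ m = 0 & e = 1 -> X \is a GRing.unit].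
Proof.
have [m [q q0 pE]] := multiplicity_XsubC (char_poly X) 0.
rewrite subr0 in pE.
have {q0} q0 : ~~ root q 0.
  by apply: (implyP q0); apply/monic_neq0/char_poly_monic.
(* The exponent [m.+1] instead of [m] leaves a factor [X] in the idempotent even when [m] is 0; this
   factor makes [X] invertible when [e = 1]. *)
have /Bezout_eq1_coprimepP [[a b] /= ab1] : coprimep ('X ^+ m.+1) q.
  by apply: coprimep_expl; rewrite coprimep_sym coprimepX.
have hXn i : horner_mx X 'X^i = X ^+ i by rewrite rmorphXn /= horner_mx_X.
pose ha := horner_mx X a; pose hb := horner_mx X b; pose hq := horner_mx X q.
have cX i r : GRing.comm (horner_mx X r) (X ^+ i).
  by rewrite -hXn; apply: comm_horner_mx2.
have qX0 : hq * X ^+ m.+1 = 0.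
  by rewrite exprSr mulrA -hXn -rmorphM -pE /= Cayley_Hamilton mul0r.
have e1 : ha * X ^+ m.+1 + hb * hq = 1.
  by rewrite -hXn -!rmorphM -rmorphD ab1 rmorph1.
have eE : horner_mx X (a * 'X^(m.+1)) = ha * X ^+ m.+1.
  by rewrite rmorphM /= hXn.
exists (a * 'X^(m.+1)), m.+1; rewrite eE /=; split=> [|e0|eq1].
- rewrite -[RHS]mul1r -e1 mulrDl -[hb * hq * _]mulrA cX.
  by rewrite [hq * _]mulrA qX0 mul0r mulr0 addr0.
- have: X ^+ m.+1 = (ha * X ^+ m.+1 + hb * hq) * X ^+ m.+1 by rewrite e1 mul1r.
  by rewrite e0 add0r -mulrA qX0 mulr0.
- have : X * (X ^+ m * ha) = 1 by rewrite mulrA -exprS -cX.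
  by case/mulmx1_unit.
Qed.

(** * The local ring of matrices commuting with a given family, and Nakayama's lemma *)

Section LocalCommutant.
Variables (k : fieldType) (n : nat) (T : Type) (rho : T -> 'M[k]_n.+1).

Definition commutant (X : 'M[k]_n.+1) : Prop := forall t, GRing.comm (rho t) X.

Hypothesis idem_trivial :
  forall e, commutant e -> e * e = e -> e = 0 \/ e = 1.

Lemma commutant_unit_or_nilpotent X :
  commutant X -> X \is a GRing.unit \/ exists m, X ^+ m = 0.
Proof.
move=> cX; have [p [m /= [ee e0 e1]]] := fitting_idempotent X.
have [|/e0 ?|/e1] := idem_trivial _ ee; [|by right; exists m|by left].
by move=> t; apply: comm_mx_horner; apply: cX.
Qed.

Definition radical (X : 'M[k]_n.+1) : Prop :=
  commutant X /\ X \isn't a GRing.unit.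

Lemma radical0 : radical 0.
Proof. by split=> [t|]; [apply: commr0|rewrite unitr0]. Qed.

Lemma radical_sub1_unit X : radical X -> 1 - X \is a GRing.unit.
Proof.
case=> cX /negP nX; have [//|[m]] := commutant_unit_or_nilpotent cX.
exact: nilpotent_sub1_unit.
Qed.

Lemma radicalMl X Y : commutant X -> radical Y -> radical (X * Y).
Proof.
move=> cX [cY nY]; split=> [t|]; first exact: commrM.
apply: contra nY; rewrite -[X * Y \is a _]/(X *m Y \in unitmx) unitmx_mul.
by case/andP.
Qed.

(** If [X + Y] were a unit [s], then [s^-1 * X = 1 - s^-1 * Y] would be both in the radical and a
    unit. *)
Lemma radicalD X Y : radical X -> radical Y -> radical (X + Y).
Proof.
move=> rX rY; have cXY : commutant (X + Y).
  by move=> t; apply: commrD; [apply: rX.1|apply: rY.1].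
split=> //; apply/negP => uXY.
have cV : commutant (X + Y)^-1 by move=> t; apply: commrV.
have /radical_sub1_unit := radicalMl cV rY.
rewrite -{1}(mulVr uXY) -mulrBr addrK => uX.
by have [_ /negP] := radicalMl cV rX; apply.
Qed.

Lemma radical_sum (I : Type) (r : seq I) (F : I -> 'M[k]_n.+1) :
  (forall i, radical (F i)) -> radical (\sum_(i <- r) F i).
Proof.
by move=> rF; apply: big_ind => //; [apply: radical0|apply: radicalD].
Qed.

Lemma radicalZ c X : radical X -> radical (c *: X).
Proof.
move=> rX; rewrite -mul_scalar_mx; apply: radicalMl => // t.
exact: scalar_mxC.
Qed.

(* Nakayama's lemma, by eliminating one generator at a time: 1 - psi is a    *)
(* unit for psi in the radical.                                              *)
Lemma radical_span_proper m (g : 'I_m -> 'rV[k]_n.+1) :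
  ~ (forall y, exists psi : 'I_m -> 'M_n.+1,
       (forall j, radical (psi j)) /\ y = \sum_j g j *m psi j).
Proof.
elim: m g => [|m IHm] g gP.
  have [psi [_]] := gP (const_mx 1); rewrite big_ord0 => /rowP/(_ 0).
  by rewrite !mxE; apply/eqP/oner_neq0.
have [psi [rpsi]] := gP (g ord_max); rewrite big_ord_recr /=.
set w := widen_ord _; set s := \sum_(i < m) _ => gE.
pose u := 1 - psi ord_max.
have uu : u \is a GRing.unit by apply: radical_sub1_unit.
have cu : commutant u^-1.
  move=> t; apply/commrV/commrB; first exact: commr1.
  by have [] := rpsi ord_max.
(* The last generator is a combination of the others, so it can be substituted away; the new
   coefficients stay in the radical. *)
have gmaxE : g ord_max = s *m u^-1.
  have -> : s = g ord_max *m u.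
    by rewrite mulmxBr mulmx1 {1}gE addrK.
  by rewrite -mulmxA -[u *m _]/(u * u^-1) divrr // mulmx1.
apply: (IHm (g \o w)) => y; have [phi [rphi ->]] := gP y.
exists (fun j => phi (w j) + psi (w j) * (u^-1 * phi ord_max)); split=> [j|].
  apply: radicalD => //; apply: radicalMl; last exact: radicalMl.
  by have [] := rpsi (w j).
rewrite big_ord_recr /= gmaxE -mulmxA mulmx_suml -big_split /=.
by apply: eq_bigr => i _; rewrite [RHS]mulmxDr -mulmxA.
Qed.

(** Expanding each [p.1] in the standard basis turns an arbitrary sum into one over fixed
    generators, to which Nakayama's lemma applies. *)
Lemma radical_image_proper :
  ~ (forall y, exists s : seq ('rV[k]_n.+1 * {X | radical X}),
       y = \sum_(p <- s) p.1 *m sval p.2).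
Proof.
move=> sP; apply: (@radical_span_proper _ (fun j => 'e_j)) => y.
have [s ->] := sP y.
exists (fun j => \sum_(p <- s) p.1 0 j *: sval p.2); split=> [j|].
  by apply: radical_sum => p; apply: radicalZ; apply: svalP.
under [RHS]eq_bigr do rewrite mulmx_sumr.
rewrite exchange_big /=; apply: eq_bigr => p _.
rewrite {1}[p.1]row_sum_delta mulmx_suml; apply: eq_bigr => j _.
by rewrite -scalemxAl -scalemxAr.
Qed.

End LocalCommutant.

(** * Modules as finite-dimensional vector spaces *)

Section Restriction.
Variables (k : fieldType) (A : falgType k).

(** The alias carries the scalar action of [k], keeping it apart from the action of [A^c] on the
    same set. *)
Definition kmod (M : rmod A) : Type := M.
HB.instance Definition _ (M : rmod A) := GRing.Zmodule.copy (kmod M) M.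

Section RestrictionOfScalars.
Variable M : rmod A.

Definition kscale (c : k) (x : kmod M) : kmod M := (c%:A : A^c) *: (x : M).

Lemma kscaleA a b v : kscale a (kscale b v) = kscale (a * b) v.
Proof.
rewrite /kscale scalerA; congr (_ *: _).
by rewrite -[LHS]/((b%:A : A) * (a%:A : A)) mulr_algl scalerA mulrC.
Qed.

Lemma kscale1 : left_id 1 kscale.
Proof. by move=> v; rewrite /kscale scale1r; exact: scale1r. Qed.

Lemma kscaleDr : right_distributive kscale +%R.
Proof. by move=> c u v; apply: scalerDr. Qed.

Lemma kscaleDl v : {morph kscale^~ v : a b / a + b}.
Proof. by move=> a b; rewrite /kscale scalerDl; exact: scalerDl. Qed.

HB.instance Definition _ := GRing.Zmodule_isLmodule.Build k (kmod M)
  kscaleA kscale1 kscaleDr kscaleDl.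

End RestrictionOfScalars.

Lemma linear_kmod (M N : rmod A) (f : {linear M -> N}) :
  linear (f : kmod M -> kmod N).
Proof. by move=> c x y; exact: linearP. Qed.

(** The products of a basis of [A] with the generators of [M] span [M] over [k]. *)
Lemma kmod_spanned (M : rmod A) :
  exists d (g : {linear 'rV[k]_d -> kmod M}), forall x, exists v, g v = x.
Proof.
have [n [g gP]] := rmod_fg M; pose e := vbasis {:A}.
pose m := \dim {:A}.
pose a (v : 'rV[k]_(n * m)) i : A^c := \sum_(j < m) vec_mx v i j *: e`_j.
pose h (v : 'rV[k]_(n * m)) : kmod M := \sum_(i < n) a v i *: g i.
have hlin : linear h.
  move=> c u v; rewrite /h scaler_sumr -big_split; apply: eq_bigr => i _ /=.
  have -> : a (c *: u + v) i = (c%:A : A^c) * a u i + a v i; last first.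
    by rewrite scalerDl -scalerA.
  rewrite -[_ * _]/((a u i : A) * (c%:A : A)) mulr_algr.
  rewrite scaler_sumr -big_split; apply: eq_bigr => j _ /=.
  by rewrite linearP !mxE scalerDl scalerA.
pose hL : {linear _ -> _} :=
  HB.pack h (GRing.isLinear.Build k _ (kmod M) _ h hlin).
exists (n * m)%N, hL => x; have [b ->] := gP x.
exists (mxvec (\matrix_(i, j) coord e j (b i : A))).
apply: eq_bigr => i _ /=; rewrite (_ : a _ i = b i) //.
rewrite /a mxvecK [RHS](coord_vbasis (memvf (b i : A))).
by apply: eq_bigr => j _; rewrite mxE.
Qed.

(** Restricting [g] to a complement of the line of [v] loses nothing. This serves to extract a
    basis, and to show that a quotient with nonzero kernel needs fewer spanning vectors. *)
Lemma span_reduce (V : lmodType k) d (g : {linear 'rV[k]_d -> V}) v :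
  (forall x, exists u, g u = x) -> v != 0 -> g v = 0 ->
  exists d' (h : {linear 'rV[k]_d' -> V}),
    (d' < d)%N /\ forall x, exists u, h u = x.
Proof.
move=> gS vn0 gv0; pose C := row_base (v^C)%MS.
exists (\rank (v^C)%MS), (g \o mulmxr C : {linear _ -> _}); split.
  have rv : \rank v = 1%N by apply/eqP; rewrite rank_rV vn0.
  rewrite mxrank_compl rv ltn_subrL /=.
  by case: d {g gS gv0 C rv} v vn0 => // v; rewrite thinmx0 eqxx.
move=> x; have [u <-] := gS x.
have /sub_addsmxP [[a b] /= ->] : (u <= v + v^C)%MS.
  exact: submx_full (addsmx_compl_full v).
have /submxP [w wE] : (b *m v^C <= C)%MS.
  by rewrite eq_row_base submxMl.
exists w; rewrite linearD /= -wE [a]mx11_scalar mul_scalar_mx linearZ /= gv0.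
by rewrite scaler0 add0r.
Qed.

Lemma kmod_basis (M : rmod A) :
  exists d (b : {linear kmod M -> 'rV[k]_d}), bijective b.
Proof.
have [d] := kmod_spanned M.
elim/ltn_ind: d => d IHd [g gS].
have [[v [vn0 gv0]]|gI] := classic (exists v, v != 0 /\ g v = 0).
  have [d' [h [ltd hS]]] := span_reduce gS vn0 gv0.
  by apply: (IHd d' ltd); exists h.
have ginj : injective g.
  apply: raddf_inj => v gv0; apply/eqP; apply: contra_notT gI => vn0.
  by exists v.
have gS' x : exists v, g v == x by have [v <-] := gS x; exists v.
pose b x := xchoose (gS' x).
have bK : cancel b g by move=> x; apply/eqP/(xchooseP (gS' x)).
have gK : cancel g b by move=> v; apply: ginj; rewrite bK.
pose bL : {linear kmod M -> 'rV[k]_d} :=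
  HB.pack b (GRing.isLinear.Build k (kmod M) _ _ b (can2_linear gK bK)).
by exists d, bL; exists g.
Qed.

End Restriction.

(** * Idempotent endomorphisms and direct summands *)

Section Idempotent.
Variables (A : pzRingType) (M : rmod A).

Section Fixed.
Variable e : {linear M -> M}.

Definition fixed_pred : {pred M} := [pred x | e x == x].

Fact fixed_submod : submod_closed fixed_pred.
Proof.
split=> [|a x y]; rewrite !inE ?linear0 // => /eqP xE /eqP yE.
by rewrite linearP xE yE.
Qed.

HB.instance Definition _ :=
  GRing.isSubmodClosed.Build _ M fixed_pred fixed_submod.
Definition fixed := {x : M | fixed_pred x}.
HB.instance Definition _ := SubChoice.on fixed.
HB.instance Definition _ := [SubChoice_isSubZmodule of fixed by <:].
HB.instance Definition _ := [SubZmodule_isSubLmodule of fixed by <:].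

Hypothesis ee : forall x, e (e x) = e x.

Definition to_fixed (x : M) : fixed := exist _ (e x) (introT eqP (ee x)).

Lemma to_fixed_linear : linear to_fixed.
Proof. by move=> a x y; apply: val_inj; rewrite /= linearP. Qed.

Lemma fixed_fg : finitely_generated fixed.
Proof.
have [n [g gP]] := rmod_fg M; exists n, (fun i => to_fixed (g i)) => x.
have [a aE] := gP (val x); exists a; apply: val_inj; rewrite raddf_sum aE /=.
rewrite -[LHS]aE -(eqP (valP x)) aE raddf_sum /=.
by apply: eq_bigr => i _; rewrite linearZ.
Qed.

End Fixed.

Definition Fixed e ee : rmod A := RMod (@fixed_fg e ee).

Lemma Fixed_eq0 e ee : is_zero (@Fixed e ee) -> forall x, e x = 0.
Proof. by move=> z x; have /(congr1 val) := z (to_fixed ee x). Qed.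

(** This is the decomposition of [M] into the images of [e] and [1 - e]. *)
Lemma idempotent_split (e : {linear M -> M}) (ee : forall x, e (e x) = e x) :
  exists2 X, isomorphic M (dsum (Fixed ee) X) &
             is_zero X -> forall x, e x = x.
Proof.
pose e' : {linear M -> M} := idfun \- e.
have ee' x : e' (e' x) = e' x by rewrite /= linearB ee subrr subr0.
exists (Fixed ee'); last first.
  by move=> z x; apply/esym/eqP; rewrite -subr_eq0; apply/eqP/(Fixed_eq0 z).
pose f x : dsum (Fixed ee) (Fixed ee') := (to_fixed ee x, to_fixed ee' x).
have fL : linear f by move=> a x y; congr pair; apply: to_fixed_linear.
pose fF : {linear M -> dsum _ _} :=
  HB.pack f (GRing.isLinear.Build _ _ _ _ f fL).
exists fF; exists (fun p : dsum (Fixed ee) (Fixed ee') => val p.1 + val p.2).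
  by move=> x; rewrite /= addrC subrK.
move=> [[x xP] [y yP]].
have ex : e x = x := eqP xP.
have ey : e y = 0.
  have /eqP : y - e y == y := yP.
  by rewrite -[RHS]subr0 => /addrI/oppr_inj.
by congr pair; apply: val_inj; rewrite /= linearD ex ey addr0 // addrC addKr.
Qed.

Lemma indecomposable_idempotent (e : {linear M -> M}) :
  indecomposable M -> (forall x, e (e x) = e x) ->
  (forall x, e x = 0) \/ (forall x, e x = x).
Proof.
move=> [_ iM] ee; have [X isoX X0] := idempotent_split ee.
by have [/Fixed_eq0|/X0] := iM _ _ isoX; [left|right].
Qed.

End Idempotent.

(** * Traces and retracts of indecomposable modules *)

Section Indecomposable.
Variables (k : fieldType) (A : falgType k).
Implicit Types (M N : rmod A) (S : rmod A -> Prop).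

Lemma isomorphic_sym M N : isomorphic M N -> isomorphic N M.
Proof.
case=> f [g fK gK].
pose G : {linear N -> M} :=
  HB.pack g (GRing.isLinear.Build _ _ _ _ g (can2_linear fK gK)).
by exists G; exists f.
Qed.

Lemma isomorphic_trans M N P :
  isomorphic M N -> isomorphic N P -> isomorphic M P.
Proof.
by case=> f bf [g bg]; exists (g \o f : {linear _ -> _}); apply: bij_comp.
Qed.

(* The modules all of whose elements are sums of images of elements of       *)
(* modules in S form a pretorsion class.                                     *)
Lemma Gen_trace S M (P : M -> Prop) :
  Gen S M -> P 0 -> (forall x y, P x -> P y -> P (x + y)) ->
  (forall N (g : {linear N -> M}) z, S N -> P (g z)) -> forall x, P x.
Proof.
pose C N := forall P : N -> Prop,
  P 0 -> (forall x y, P x -> P y -> P (x + y)) ->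
  (forall N' (g : {linear N' -> N}) z, S N' -> P (g z)) -> forall x, P x.
have Cquot N N' : quotient_of N N' -> C N -> C N'.
  move=> [f fS] CN Q Q0 QD QS y; have [x <-] := fS y.
  apply: (CN (fun x => Q (f x))) => [|u v Qu Qv|N1 g z SN1].
  - by rewrite linear0.
  - by rewrite linearD; apply: QD.
  - exact: (QS _ (f \o g : {linear _ -> _})).
have CP : is_pretorsion C.
  split=> // [N N' [f [g _ gK]]|N N0 Q Q0 _ _ x|N N' CN CN' Q Q0 QD QS [x y]].
  - by apply: Cquot; exists f => y; exists (g y).
  - by rewrite [x]N0.
  pose i1 (u : N) : dsum N N' := (u, 0); pose i2 (u : N') : dsum N N' := (0, u).
  have i1L : linear i1.
    by move=> c u v; congr pair; rewrite /= scaler0 addr0.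
  have i2L : linear i2.
    by move=> c u v; congr pair; rewrite /= scaler0 addr0.
  pose I1 : {linear N -> dsum N N'} :=
    HB.pack i1 (GRing.isLinear.Build _ _ _ _ i1 i1L).
  pose I2 : {linear N' -> dsum N N'} :=
    HB.pack i2 (GRing.isLinear.Build _ _ _ _ i2 i2L).
  have -> : (x, y) = I1 x + I2 y :> dsum N N'.
    by congr pair; rewrite /= ?addr0 ?add0r.
  apply: (QD);
    [apply: (CN (fun x => Q (I1 x))) | apply: (CN' (fun x => Q (I2 x)))].
  - by rewrite linear0.
  - by move=> u v Qu Qv; rewrite linearD; apply: QD.
  - by move=> N1 g z SN1; apply: (QS _ (I1 \o g : {linear _ -> _})).
  - by rewrite linear0.
  - by move=> u v Qu Qv; rewrite linearD; apply: QD.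
  - by move=> N1 g z SN1; apply: (QS _ (I2 \o g : {linear _ -> _})).
move=> GM P0 PD PS; have CM : C M.
  apply: (GM (PretorsionClass CP)) => N SN Q Q0 QD QS x.
  exact: (QS N idfun).
exact: CM.
Qed.

(* Otherwise M would be the image of the radical of its endomorphism ring.   *)
Lemma indecomposable_retract S M :
  indecomposable M -> Gen S M -> (forall N, S N -> Gen1 M N) ->
  exists2 N, S N &
    exists (f : {linear M -> N}) (g : {linear N -> M}), bijective (g \o f).
Proof.
move=> iM GM SM; have [d [b [b' bK b'K]]] := kmod_basis M.
case: d b b' bK b'K => [|n] b b' bK b'K.
  case: iM => -[] x.
  by rewrite -[x]bK -[0 in RHS]bK [b x]thinmx0 [b 0]thinmx0.
pose B' : {linear 'rV[k]_n.+1 -> kmod M} :=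
  HB.pack b' (GRing.isLinear.Build k _ (kmod M) _ b' (can2_linear bK b'K)).
pose mx (f : {linear kmod M -> kmod M}) : 'M[k]_n.+1 :=
  lin1_mx (b \o f \o B' : {linear _ -> _}).
have mxE (f : {linear kmod M -> kmod M}) x : b (f x) = b x *m mx f.
  by rewrite mul_rV_lin1 /= bK.
have mx_ext (X Y : 'M[k]_n.+1) : (forall x, b x *m X = b x *m Y) -> X = Y.
  by move=> eXY; apply/row_matrixP => i; rewrite !rowE -[delta_mx _ _]b'K.
have act_lin (a : A^c) : linear (fun x : kmod M => a *: (x : M) : kmod M).
  move=> c x y; have cca : a * (c%:A : A^c) = (c%:A : A^c) * a.
    rewrite -[LHS]/((c%:A : A) * (a : A)) -[RHS]/((a : A) * (c%:A : A)).
    by rewrite mulr_algl mulr_algr.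
  have e : a *: ((c%:A : A^c) *: (x : M) + (y : M)) =
           (c%:A : A^c) *: (a *: (x : M)) + a *: (y : M).
    by rewrite scalerDr !scalerA cca.
  exact: e.
pose act a : {linear kmod M -> kmod M} :=
  HB.pack (fun x : kmod M => a *: (x : M) : kmod M)
    (GRing.isLinear.Build k (kmod M) (kmod M) _ _ (act_lin a)).
(* The matrices commuting with all [rho a] are those of the [A]-linear endomorphisms of [M]. *)
pose rho a := mx (act a).
have rhoE a (x : M) : b (a *: x) = b x *m rho a by rewrite -mxE.
pose toK (f : {linear M -> M}) : {linear kmod M -> kmod M} :=
  HB.pack (f : kmod M -> kmod M)
    (GRing.isLinear.Build k (kmod M) (kmod M) _ _ (linear_kmod f)).
have mx_comm f : commutant rho (mx (toK f)).
  move=> a; apply: mx_ext => x; rewrite [LHS]mulmxA [RHS]mulmxA.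
  by rewrite -!mxE /= linearZ.
have idem e : commutant rho e -> e * e = e -> e = 0 \/ e = 1.
  move=> ce ee; pose f (x : M) : M := b' (b x *m e).
  have fL : linear f.
    move=> a x y; apply: (can_inj bK); rewrite b'K.
    apply/esym; apply: (etrans (linearD b _ _)).
    rewrite rhoE /f !b'K.
    have -> : b (a *: x + y) = b (a *: x) + b y by exact: linearD.
    rewrite rhoE mulmxDl -!mulmxA; congr (_ *m _ + _).
    by rewrite -[LHS]/(e * rho a) -ce.
  pose fF : {linear M -> M} := HB.pack f (GRing.isLinear.Build _ _ _ _ f fL).
  have ff x : fF (fF x) = fF x.
    by rewrite /= /f b'K -mulmxA -[e *m e]/(e * e) ee.
  have [f0|f1] := indecomposable_idempotent iM ff; [left|right].
    apply: mx_ext => x; rewrite mulmx0 -[LHS]b'K -[b' _]/(fF x) f0.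
    exact: (linear0 b).
  by apply: mx_ext => x; rewrite mulmx1 -[LHS]b'K -[b' _]/(fF x) f1.
have mx_unit f : mx (toK f) \is a GRing.unit -> bijective f.
  move=> fu; exists (fun x => b' (b x *m (mx (toK f))^-1)) => x.
    by rewrite -[f x]/(toK f x) mxE mulmxK ?bK.
  by apply: (can_inj bK); rewrite -[f _]/(toK f _) mxE b'K mulmxKV.
apply: NNPP => noN; apply: (radical_image_proper idem) => y.
pose P (x : M) := exists s : seq ('rV[k]_n.+1 * {X | radical rho X}),
  b x = \sum_(p <- s) p.1 *m sval p.2.
suff /(_ (b' y)) : forall x, P x by rewrite /P b'K.
have P0 : P 0 by exists [::]; rewrite big_nil; exact: (linear0 b).
have PD u v : P u -> P v -> P (u + v).
  move=> [s sE] [t tE]; exists (s ++ t); rewrite big_cat -sE -tE.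
  exact: (linearD b).
(* Elements of [M] are sums of [g z] with [z] in some [N] of [S], and [z] in turn is a sum of images
   [f x] of elements of [M]; so only composites [g \o f] matter. *)
apply: (Gen_trace GM) => // N g z SN.
apply: (Gen_trace (P := fun z => P (g z)) (SM N SN)) => [|u v Pu Pv|N' f x eN'].
- by rewrite linear0.
- by rewrite linearD; apply: PD.
subst N'; have rgf : radical rho (mx (toK (g \o f : {linear _ -> _}))).
  split=> //; apply/negP => /mx_unit bgf; apply: noN; exists N => //.
  by exists f, g.
by exists [:: (b x, exist _ _ rgf)]; rewrite big_seq1 -mxE.
Qed.

Lemma indecomposable_isomorphic M N :
  isomorphic M N -> indecomposable M -> indecomposable N.
Proof.
move=> iMN [nM iM]; split=> [N0|X Y iN].
  case: iMN nM => f [g fK _] [] x.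
  by rewrite -[x]fK -[0 in RHS]fK [f x]N0 [f 0]N0.
exact: iM (isomorphic_trans iMN iN).
Qed.

Lemma isomorphic_quotient M N : isomorphic M N -> quotient_of M N.
Proof. by case=> f [g _ gK]; exists f => y; exists (g y). Qed.

(** * Indecomposables and completely join-irreducible classes *)

Lemma pretorsion_le_antisym (C D : pretorsion_class A) :
  pretorsion_le C D -> pretorsion_le D C -> C = D.
Proof.
case: C D => [C CP] [D DP] CD DC.
have eCD : C = D.
  apply: functional_extensionality => M; apply: propositional_extensionality.
  by split; [apply: CD | apply: DC].
case: D / eCD DP CD DC => DP _ _.
by congr PretorsionClass; apply: proof_irrelevance.
Qed.

Lemma Gen1_self M : Gen1 M M.
Proof. exact: sub_Gen. Qed.

Lemma Gen1_le M (C : pretorsion_class A) : C M -> pretorsion_le (Gen1 M) C.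
Proof. by move=> CM; apply: Gen_least => _ ->. Qed.

Lemma quotient_Gen1 M N : quotient_of M N -> Gen1 M N.
Proof.
by move/pretorsion_quotient; apply; [apply: in_classP|apply: Gen1_self].
Qed.

Lemma retract_Gen1 M N (f : {linear M -> N}) (g : {linear N -> M}) :
  bijective (g \o f) -> Gen1 N M.
Proof.
case=> h _ hK; apply: quotient_Gen1; exists g => y.
by exists (f (h y)); apply: hK.
Qed.

Lemma Gen1_indecomposable_inj M N :
  indecomposable M -> indecomposable N -> Gen1 M = Gen1 N -> isomorphic M N.
Proof.
move=> iM iN eMN.
have GMN : Gen1 N M by rewrite -eMN; apply: Gen1_self.
have [_ -> [f [g [h hK Kh]]]] : exists2 N', N' = N &
    exists (f : {linear M -> N'}) (g : {linear N' -> M}), bijective (g \o f).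
  apply: indecomposable_retract iM GMN _ => _ ->.
  by rewrite eMN; apply: Gen1_self.
have hL := can2_linear (f := (g \o f : {linear _ -> _})) hK Kh.
pose H : {linear M -> M} := HB.pack h (GRing.isLinear.Build _ _ _ _ h hL).
(* This projects [N] onto its summand isomorphic to [M]. It is nonzero because [M] is, hence the
   identity, and [h \o g] inverts [f]. *)
pose e : {linear N -> N} := f \o H \o g.
have ee x : e (e x) = e x by congr (f (h _)); apply: Kh.
have [e0|e1] := indecomposable_idempotent iN ee.
  case: iM => -[] x; rewrite -[x]Kh.
  have -> : (g \o f) (h x) = g (e (f (h x))) by rewrite /= (hK (h x)).
  by rewrite e0 linear0.
exists f; exists (h \o g); first exact: hK.
exact: e1.
Qed.

(** Induction on the number of spanning vectors: the summands of a decomposable module of [C] are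
    quotients of it with nonzero kernel, so they lie in [C] and have smaller spanning sets. *)
Lemma pretorsion_le_indecomposable (C D : pretorsion_class A) :
  (forall M, indecomposable M -> C M -> D M) -> pretorsion_le C D.
Proof.
move=> CD M; have [d [g]] := kmod_spanned M.
elim/ltn_ind: d M g => d IHd M g gS CM.
have [/CD|nM] := classic (indecomposable M); first exact.
have [M0|nM0] := classic (is_zero M).
  exact: (pretorsion_zero (in_classP D)).
have [X [Y [iXY [nX nY]]]] : exists X Y,
    isomorphic M (dsum X Y) /\ ~ is_zero X /\ ~ is_zero Y.
  apply: NNPP => nXY; apply: nM; split=> // X Y iXY.
  apply: NNPP => /not_or_and[nX nY]; apply: nXY; by exists X, Y.
have proper_quot N (f : {linear M -> N}) x :
    (forall y, exists x, f x = y) -> x <> 0 -> f x = 0 -> D N.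
  move=> fS xn0 fx0.
  pose fK : {linear kmod M -> kmod N} := HB.pack (f : kmod M -> kmod N)
    (GRing.isLinear.Build k (kmod M) (kmod N) _ _ (linear_kmod f)).
  have [v gv] := gS x.
  have [|||d' [h [ltd hS]]] := @span_reduce _ _ _ (fK \o g : {linear _ -> _}) v.
  - by move=> y; have [z <-] := fS y; have [w <-] := gS z; exists w.
  - by apply/eqP => v0; apply: xn0; rewrite -gv v0 linear0.
  - by rewrite /= gv.
  apply: (IHd d' ltd N h hS).
  by apply: (pretorsion_quotient (in_classP C)) CM; exists f.
have [f [g' fK gK]] := iXY.
pose P1 : {linear dsum X Y -> X} := fst.
pose P2 : {linear dsum X Y -> Y} := snd.
have nz (p : dsum X Y) : p <> 0 -> g' p <> 0.
  by move=> pn0 gp0; apply: pn0; rewrite -[p]gK gp0 linear0.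
apply: (pretorsion_iso (in_classP D) (isomorphic_sym iXY)).
apply: (pretorsion_dsum (in_classP D)).
  have [y yn0] := not_all_ex_not _ _ nY.
  apply: (proper_quot X (P1 \o f : {linear _ -> _}) (g' (0, y))).
  - by move=> x; exists (g' (x, 0)); rewrite /= gK.
  - by apply: nz => -[].
  - by rewrite /= gK.
have [x xn0] := not_all_ex_not _ _ nX.
apply: (proper_quot Y (P2 \o f : {linear _ -> _}) (g' (x, 0))).
- by move=> y; exists (g' (0, y)); rewrite /= gK.
- by apply: nz => -[].
- by rewrite /= gK.
Qed.

(** Otherwise every [Gen1 M] with [M] indecomposable in [C] would lie strictly below [C], hence
    below [C0], which forces [C = C0]. *)
Lemma cji_indecomposable (C : pretorsion_class A) :
  completely_join_irreducible (@pretorsion_le A) C ->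
  exists2 M, indecomposable M & C = Gen1 M.
Proof.
move=> [_ [C0 [nC0 C0P]]]; apply: NNPP => nM.
have [leC0 _] := (C0P C0).2 (fun _ => id).
apply: nC0; apply: pretorsion_le_antisym => //.
apply: pretorsion_le_indecomposable => M iM CM.
suff /C0P leM : strictly_below (@pretorsion_le A) (Gen1 M) C.
  exact: leM _ (@Gen1_self M).
by split=> [|eM]; [apply: Gen1_le | apply: nM; exists M].
Qed.

Lemma indecomposable_cji M : indecomposable M ->
  completely_join_irreducible (@pretorsion_le A) (Gen1 M).
Proof.
move=> iM; have [nM _] := iM.
have zeroP (N P : rmod A) : is_zero N -> Gen1 N P -> is_zero P.
  move=> N0 GN x; apply: (Gen_trace (P := fun x => x = 0) GN) => //.
    by move=> u v -> ->; rewrite addr0.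
  move=> N' g z eN'; subst N'; by rewrite (N0 z) linear0.
split.
  move=> bot; apply: nM; apply: (zeroP (rmod0 A)).
    by move=> x; apply/rowP=> -[].
  exact: (bot _ _ (@Gen1_self M)).
pose C0 N := Gen1 M N /\ ~ Gen1 N M.
have Cquot N N' : quotient_of N N' -> C0 N -> C0 N'.
  move=> qNN' [MN nNM]; split.
    exact: (pretorsion_quotient (in_classP (Gen1 M)) qNN' MN).
  by move=> N'M; apply: nNM; apply: Gen1_le N'M; apply: quotient_Gen1.
have C0P : is_pretorsion C0.
  split=> // [N N' /isomorphic_quotient|N N0|N N' [MN nNM] [MN' nN'M]].
  - exact: Cquot.
  - split; first exact: (pretorsion_zero (in_classP (Gen1 M))).
    by move=> /(zeroP _ _ N0).
  split=> [|GM]; first exact: (pretorsion_dsum (in_classP (Gen1 M))).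
  (* By [indecomposable_retract], [M] is a retract of [N] or of [N'], so one of the two would
     generate it. *)
  pose S P := P = N \/ P = N'.
  have GSM : Gen S M.
    apply: Gen1_le GM.
    by apply: (pretorsion_dsum (in_classP (Gen S)));
      apply: sub_Gen; [left|right].
  have [|P [->|->] [f [g /retract_Gen1]]] // := indecomposable_retract iM GSM.
  by move=> P [->|->].
exists (PretorsionClass C0P); split=> [eC|C].
  by have := @Gen1_self M; rewrite -eC => -[_ []]; apply: Gen1_self.
split=> [[leC nC] N CN|leC].
  split; first exact: leC.
  move=> NM; apply: nC; apply: pretorsion_le_antisym => //.
  by apply: Gen1_le; apply: Gen1_le NM.
split=> [N /leC[] //|eC]; have := @Gen1_self M; rewrite -eC => /leC[_].
by apply; apply: Gen1_self.
Qed.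

Lemma Gen1_iso M N : isomorphic M N -> Gen1 M = Gen1 N.
Proof.
move=> iMN; apply: pretorsion_le_antisym; apply: Gen1_le; apply: quotient_Gen1.
  exact/isomorphic_quotient/isomorphic_sym.
exact: isomorphic_quotient.
Qed.

(** * The two inverse maps *)

Lemma Gen_iso_class M : Gen (iso_class M) = Gen1 M.
Proof.
apply: pretorsion_le_antisym; last first.
  by apply: Gen1_le; apply: sub_Gen; exists idfun; exists idfun.
by apply: Gen_least => N /isomorphic_quotient/quotient_Gen1.
Qed.

Lemma Gen_indec_iso_class_cji (K : indec_iso_class A) :
  completely_join_irreducible (@pretorsion_le A) (Gen (sval K)).
Proof.
have [M [iM ->]] := svalP K.
by rewrite Gen_iso_class; apply: indecomposable_cji.
Qed.

(** This underlies the inverse map: for completely join-irreducible [C] it is a whole isomorphism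
    class, so no representative has to be chosen. *)
Definition indecomposable_generators (C : pretorsion_class A) (M : rmod A) :=
  indecomposable M /\ C = Gen1 M.

Lemma indecomposable_generatorsE M :
  indecomposable M -> indecomposable_generators (Gen1 M) = iso_class M.
Proof.
move=> iM; apply: functional_extensionality => N.
apply: propositional_extensionality; split=> [[iN eMN]|iMN].
  exact: Gen1_indecomposable_inj.
by split; [apply: indecomposable_isomorphic iM|apply: Gen1_iso].
Qed.

Lemma cji_generators_iso_class (C : cji_pretorsion A) :
  exists M, indecomposable M /\
    indecomposable_generators (sval C) = iso_class M.
Proof.
have [M iM ->] := cji_indecomposable (svalP C).
by exists M; split=> //; apply: indecomposable_generatorsE.
Qed.

End Indecomposable.

Theorem theorem3p10 (k : closedFieldType) (A : falgType k) :
  exists f : indec_iso_class A -> cji_pretorsion A,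
    bijective f /\
    forall (M : rmod A) (hM : indecomposable M),
      sval (f (to_indec_iso_class hM)) = Gen1 M.
Proof.
exists (fun K => exist _ _ (Gen_indec_iso_class_cji K)); split; last first.
  by move=> M hM; apply: Gen_iso_class.
pose g (C : cji_pretorsion A) : indec_iso_class A :=
  exist _ _ (cji_generators_iso_class C).
exists g => [K|C];
  apply: eq_sig_hprop => [?|/=]; try exact: proof_irrelevance.
  have [M [iM ->]] := svalP K.
  by rewrite Gen_iso_class indecomposable_generatorsE.
have [M iM ->] := cji_indecomposable (svalP C).
by rewrite indecomposable_generatorsE // Gen_iso_class.
Qed.
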